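(* Let $(\mathscr{D},q)$ be a finite quadratic form. Then there exists a group automorphism $\gamma$ of $\mathscr{D}$ with $q\circ\gamma=-q$ (i.e. $(\mathscr{D},q)\cong(\mathscr{D},-q)$) if and only if the Gauss sums $\tau_n(q)=\sum_{x\in\mathscr{D}}e^{2\pi i n q(x)}$ are real numbers for all $n=1,2,3,\dots$.
   Context: A finite quadratic form $(\mathscr{D},q)$ is a finite abelian group $\mathscr{D}$ with a map $q:\mathscr{D}\to\mathbb{Q}/\mathbb{Z}$ such that $q(nx)=n^2q(x)$ for all $n\in\mathbb{Z}$, $x\in\mathscr{D}$, and $b(x,y)=q(x+y)-q(x)-q(y)$ is a non-degenerate symmetric bilinear form $\mathscr{D}\times\mathscr{D}\to\mathbb{Q}/\mathbb{Z}$. *)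

(* Defs.v *)
From HB Require Import structures.
From mathcomp Require Import all_boot all_order all_algebra.
From mathcomp Require Import reals trigo Rstruct complex.
Set Implicit Arguments. Unset Strict Implicit. Unset Printing Implicit Defensive.
Import Order.TTheory GRing.Theory Num.Theory.
Local Open Scope ring_scope.

(* Q/Z is modelled by rat modulo Num.int: a value of q is a rational representative. *)
Definition eqQZ (a b : rat) : Prop := (a - b) \is a Num.int.

Section FQF.
Variable D : finZmodType.
Variable q : D -> rat.

Definition bform (x y : D) : rat := q (x + y) - q x - q y.

Definition is_fin_quad_form : Prop :=
  [/\ (forall (n : int) (x : D), eqQZ (q (x *~ n)) ((n ^+ 2)%:~R * q x)),
      (forall x y z : D, eqQZ (bform (x + y) z) (bform x z + bform y z)),
      (forall x y z : D, eqQZ (bform x (y + z)) (bform x y + bform x z)) &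
      (forall x : D, (forall y : D, eqQZ (bform x y) 0) -> x = 0)].

Definition expi (t : Rdefinitions.R) : Rdefinitions.R[i] :=
  (cos t +i* sin t)%C.

Definition gauss_sum (n : nat) : Rdefinitions.R[i] :=
  \sum_(x : D) expi (2 * pi * (n%:R * ratr (q x))).
End FQF.

(* Main.v *)
Require Import Defs.
From HB Require Import structures.
From mathcomp Require Import all_boot all_order all_algebra.
From mathcomp Require Import reals trigo Rstruct complex.
From mathcomp Require Import ring lra zify.
Set Implicit Arguments. Unset Strict Implicit. Unset Printing Implicit Defensive.
Import Order.TTheory GRing.Theory Num.Theory.
Local Open Scope ring_scope.

(* If gamma exists, reindexing by it shows that each Gauss sum equals its
   conjugate.  Conversely, let all Gauss sums of q be real.  By Fourier inversion
   over Z/N, the number of maps f : D -> D with prescribed values of q (f x) and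
   q (f x - f y) is a combination of the Gauss sums of L (x) q, for integral
   lattices L.  If all of these are real, there are as many f with
   q (f x) = - q x and q (f x - f y) = - q (x - y) as f with q (f x) = q x and
   q (f x - f y) = q (x - y).  The identity is one of the latter, and by
   nondegeneracy any of the former is an automorphism.

   The Gauss sum of L (x) q is real: by the Chinese remainder theorem q may be
   assumed to take values in Z/p^k.  Then L splits modulo p^k into unary lattices,
   which contribute Gauss sums of q, and multiples of binary lattices with Gram
   matrix [[a, e], [e, c]], where p divides a and c but not e.  Such a binary
   lattice M satisfies M ~ - M modulo p^k (for p = 2 this covers both even
   unimodular planes), hence contributes a real factor. *)

(** * Finite groups, quadratic maps and their polar forms *)

HB.instance Definition _ (I : finType) (D : finZmodType) :=
  Finite.on {ffun I -> D}.
HB.instance Definition _ (D E : finZmodType) := Finite.on (D * E)%type.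

(** Translation by [x] permutes [D], so adding [x *+ #|D|] to the sum of all elements leaves it
    unchanged. *)
Lemma mulrn_card (D : finZmodType) (x : D) : x *+ #|D| = 0.
Proof.
apply: (addIr (\sum_(y : D) y)); rewrite add0r [RHS](reindex_inj (addrI x)) /=.
by rewrite big_split /= sumr_const.
Qed.

Definition polar (X : zmodType) (V : pzRingType) (q : X -> V) (x y : X) : V :=
  q (x + y) - q x - q y.

Definition quadratic (X : zmodType) (V : pzRingType) (q : X -> V) : Prop :=
  (forall (n : int) (x : X), q (x *~ n) = (n ^+ 2)%:~R * q x) /\
  (forall x y z : X, polar q (x + y) z = polar q x z + polar q y z).

Section Quadratic.
Variables (X : zmodType) (V : comPzRingType) (q : X -> V).
Hypothesis q_quad : quadratic q.
Local Notation b := (polar q).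

Lemma quadraticD (x y : X) : q (x + y) = q x + q y + b x y.
Proof. by rewrite /polar; ring. Qed.

Lemma quadratic0 : q 0 = 0.
Proof. by rewrite -(mulr0z 0) q_quad.1 expr0n mul0r. Qed.

Lemma quadraticN (x : X) : q (- x) = q x.
Proof. by rewrite -[- x]mulrN1z q_quad.1 sqrrN expr1n mul1r. Qed.

Lemma polarC (x y : X) : b x y = b y x.
Proof. by rewrite /polar [y + x]addrC; ring. Qed.

Lemma polarDl (x y z : X) : b (x + y) z = b x z + b y z.
Proof. exact: q_quad.2. Qed.

Lemma polarDr (x y z : X) : b z (x + y) = b z x + b z y.
Proof. by rewrite !(polarC z) polarDl. Qed.

Lemma polar0r (z : X) : b z 0 = 0.
Proof. by apply: (addrI (b z 0)); rewrite -polarDr !addr0. Qed.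

Lemma polarNr (x z : X) : b z (- x) = - b z x.
Proof. by apply: (addrI (b z x)); rewrite -polarDr !subrr polar0r. Qed.

Lemma polarNl (x z : X) : b (- x) z = - b x z.
Proof. by rewrite polarC polarNr polarC. Qed.

Lemma polarBr (x y z : X) : b z (x - y) = b z x - b z y.
Proof. by rewrite polarDr polarNr. Qed.

Fact polar_additive (z : X) : zmod_morphism (b z).
Proof. by move=> x y; rewrite polarBr. Qed.

Definition polar_hom (z : X) : {additive X -> V} :=
  HB.pack (b z) (GRing.isZmodMorphism.Build X V (b z) (polar_additive z)).

Lemma polarMr (n : int) (x z : X) : b z (x *~ n) = n%:~R * b z x.
Proof. by have := raddfMz (polar_hom z) n x; rewrite /= mulrzl. Qed.

Lemma polarMl (n : int) (x z : X) : b (x *~ n) z = n%:~R * b x z.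
Proof. by rewrite polarC polarMr polarC. Qed.

Lemma polar_sumr (I : finType) (F : I -> X) (z : X) :
  b z (\sum_i F i) = \sum_i b z (F i).
Proof. exact: (raddf_sum (polar_hom z)). Qed.

Lemma polar_diag (x : X) : b x x = 2 * q x.
Proof. by rewrite /polar -mulr2n -[x *+ 2]/(x *~ 2) q_quad.1; ring. Qed.

Lemma quadraticZ (c : V) : quadratic (fun x => c * q x).
Proof.
split=> [n x|x y z]; first by rewrite q_quad.1; ring.
have := polarDl x y z; rewrite /polar => h.
by rewrite -!mulrBr h; ring.
Qed.

End Quadratic.

(** * Character sums of quadratic maps and their factorizations *)

Section CharacterSums.
Variables (C : numClosedFieldType) (V : comPzRingType) (psi : V -> C).
Hypothesis psi0 : psi 0 = 1.
Hypothesis psiD : forall u v, psi (u + v) = psi u * psi v.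
Hypothesis psiN : forall v, psi (- v) = (psi v)^*.

Definition charsum (X : finType) (Q : X -> V) : C := \sum_x psi (Q x).

Lemma eq_charsum (X : finType) (Q Q' : X -> V) :
  Q =1 Q' -> charsum Q = charsum Q'.
Proof. by move=> eQ; apply: eq_bigr => x _; rewrite eQ. Qed.

Lemma charsum_bij (X Y : finType) (f : Y -> X) (Q : X -> V) :
  bijective f -> charsum (Q \o f) = charsum Q.
Proof. by move=> [g fg gf]; rewrite /charsum [RHS](reindex f) //; exists g => x _. Qed.

Lemma charsum_real_of_neg (X : finType) (Q : X -> V) (f : X -> X) :
  bijective f -> (forall x, Q (f x) = - Q x) -> charsum Q \is Num.real.
Proof.
move=> bf Qf; apply/CrealP; rewrite -[RHS](charsum_bij Q bf) rmorph_sum /=.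
by apply: eq_bigr => x _; rewrite /= Qf psiN.
Qed.

Lemma card_zmod_neq0 (X : finZmodType) : #|X|%:R != 0 :> C.
Proof. by rewrite pnatr_eq0 -lt0n; apply/card_gt0P; exists 0. Qed.

Lemma sum_shift (X : finZmodType) (F : X -> C) (a : X) :
  \sum_x F (x + a) = \sum_x F x.
Proof. by rewrite [RHS](reindex_inj (addIr a)). Qed.

(** On the values of [Q], [e1] and [e2] act as complementary idempotents. Substituting [y = x + w]
    in the double sum and using [e2 ^+ 2 = e2 - e1 * e2], the exponent [e1 Q(x) + e2 Q(y)] becomes
    [Q(x + e2 w)], whose sum over [x] is independent of [w]. *)
Lemma charsum_coprime (X : finZmodType) (Q : X -> V) (e1 e2 : int) :
  quadratic Q -> e1 + e2 = 1 -> (forall x, (e1 * e2)%:~R * Q x = 0) ->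
  #|X|%:R * charsum Q =
    charsum (fun x => e1%:~R * Q x) * charsum (fun x => e2%:~R * Q x).
Proof.
move=> qQ e12 kQ; rewrite [RHS]mulr_suml.
under [RHS]eq_bigr => x _.
  rewrite /charsum mulr_sumr (reindex_inj (addrI x)) /=.
  under eq_bigr => w _.
    have -> : psi (e1%:~R * Q x) * psi (e2%:~R * Q (x + w)) =
              psi (Q (x + w *~ e2)).
      rewrite -psiD; congr psi.
      rewrite !(quadraticD Q) (polarMr qQ) qQ.1.
      have -> : e2 ^+ 2 = e2 - e1 * e2 by rewrite -[X in X - _]mulr1 -e12; ring.
      rewrite [X in _ = X + _ + _](_ : Q x = (e1 + e2)%:~R * Q x); last first.
        by rewrite e12 mul1r.
      by rewrite rmorphB mulrBl kQ rmorphD /=; ring.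
    over.
  over.
rewrite exchange_big /=.
under eq_bigr => w _.
  rewrite (sum_shift (psi \o Q)).
  over.
by rewrite sumr_const mulr_natl.
Qed.

(** The map [d \o s] projects [X] onto a copy of [Y] that is orthogonal to its kernel, so the sum
    factors. The last factor runs over all of [X] and thus meets each element of the kernel [#|Y|]
    times, whence the factor on the left. *)
Lemma charsum_split (X Y : finZmodType) (Q : X -> V)
    (d : {additive Y -> X}) (s : {additive X -> Y}) :
  (forall y, s (d y) = y) ->
  (forall y x, polar Q (d y) (x - d (s x)) = 0) ->
  #|Y|%:R * charsum Q = charsum (Q \o d) * charsum (fun x => Q (x - d (s x))).
Proof.
move=> sd orth.
have split x : psi (Q x) = psi (Q (d (s x))) * psi (Q (x - d (s x))).
  rewrite -psiD; congr psi; have := orth (s x) x.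
  rewrite /polar [d _ + _]addrC subrK => /eqP.
  by rewrite subr_eq add0r subr_eq addrC => /eqP.
(* For each of the [#|Y|] copies of the sum, [x] is translated by [d y], which moves only its
   component in the image of [d]. *)
transitivity (\sum_(y : Y) \sum_(x : X) psi (Q (d (y + s x))) * psi (Q (x - d (s x)))).
  rewrite mulr_natl -sumr_const; apply: eq_bigr => y _.
  rewrite /charsum (reindex_inj (addrI (d y))) /=; apply: eq_bigr => x _.
  rewrite split; congr (psi (Q _) * psi (Q _)); first by rewrite raddfD /= sd.
  by rewrite !raddfD /= sd addrACA subrr add0r.
rewrite exchange_big mulr_sumr /=; apply: eq_bigr => x _.
rewrite -mulr_suml; congr (_ * _).
exact: (sum_shift (fun y => psi (Q (d y)))).
Qed.
End CharacterSums.

(** * Congruences modulo prime powers *)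

Section Congruences.
Variable p : nat.
Hypothesis p_prime : prime p.

Lemma coprimez_prime (m : int) : coprimez p m = ~~ (p %| m)%Z.
Proof. by rewrite coprimezE prime_coprime // dvdzE. Qed.

Lemma modular_inverse (m : int) (k : nat) :
  ~~ (p %| m)%Z -> exists u, (p%:Z ^+ k %| 1 - u * m)%Z.
Proof.
rewrite -coprimez_prime => /(coprimezXl k) /coprimezP [[u v] /= uv].
by exists v; apply/dvdzP; exists u; rewrite -uv; ring.
Qed.

(** As [p] divides [d], the derivative [2 d t + b] is a unit modulo [p] for every [t]; Newton steps
    therefore lift a root from each power of [p] to the next. *)
Lemma quadratic_hensel (d b : int) (k : nat) :
  (p %| d)%Z -> ~~ (p %| b)%Z ->
  exists t, (p%:Z ^+ k %| d * t ^+ 2 + b * t + 1)%Z.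
Proof.
move=> /dvdzP [d' ->] pNb; elim: k => [|k [t /dvdzP [r rt]]].
  by exists 0; rewrite expr0 dvd1z.
have [u /dvdzP [v uv]] := modular_inverse 1 pNb.
(* Newton step: the current value is [r p^k], and [u] inverts the derivative modulo [p]. *)
exists (t - p%:Z ^+ k * (r * u)); apply/dvdzP.
exists (r * v - 2 * d' * t * r * u + d' * p%:Z ^+ k * (r * u) ^+ 2).
have -> : forall x y : int, d' * p%:Z * (t - x * y) ^+ 2 + b * (t - x * y) + 1 =
    (d' * p%:Z * t ^+ 2 + b * t + 1) + d' * p%:Z * (x ^+ 2 * y ^+ 2 - 2 * t * x * y)
     - b * x * y by move=> x y; ring.
rewrite rt.
have -> : b * p%:Z ^+ k * (r * u) = p%:Z ^+ k * r * (1 - v * p%:Z ^+ 1).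
  by rewrite -uv; ring.
by rewrite (exprS _ k) expr1; ring.
Qed.

(** If [2 d] is congruent to [a c], then [N + 1] is congruent to [2 (d t^2 + b t + 1)], and
    [quadratic_hensel] applies. Working modulo [p ^ k.+1] makes [p] divide [N + 1] even for [k = 0],
    so [N] is prime to [p]. *)
Lemma neg_multiplier (a c b : int) (k n : nat) :
  (0 < n)%N -> (p %| a)%Z -> (p %| c)%Z -> ~~ (p %| b)%Z ->
  exists t, let N := a * c * t ^+ 2 + 2 * b * t + 1 in
    (p%:Z ^+ k %| N + 1)%Z /\ coprimez N n.
Proof.
move=> n_gt0 pa pc pNb.
(* [d] is half of [a c]: an exact half if [p = 2], where 4 divides [a c]; otherwise a half modulo
   [p ^ k.+1], with [(p ^ k.+1 + 1) / 2] as inverse of 2. *)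
have [d pd /dvdzP [h hd]] : exists2 d, (p %| d)%Z & (p%:Z ^+ k.+1 %| 2 * d - a * c)%Z.
  have [p2|podd] := even_prime p_prime.
    move: pa pc; rewrite p2 => /dvdzP [a' ->] /dvdzP [c' ->].
    exists (a' * c' * 2); first exact: dvdz_mull.
    by apply/dvdzP; exists 0; ring.
  have [m pm] : exists m, p%:Z ^+ k.+1 + 1 = 2 * m.
    exists (((p ^ k.+1).+1)./2%:Z).
    have -> : p%:Z ^+ k.+1 = (p ^ k.+1)%N by rewrite -!natz natrX.
    have := odd_double_half (p ^ k.+1).+1.
    by rewrite oddS oddX podd orbT /= -muln2; lia.
  exists (a * c * m); first by rewrite -mulrA; apply: dvdz_mulr.
  apply/dvdzP; exists (a * c).
  by rewrite mulrCA -pm; ring.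
have [t0 /dvdzP [r rt]] := quadratic_hensel k.+1 pd pNb.
have ht0 : a * c * t0 ^+ 2 + 2 * b * t0 + 2 = (2 * r - h * t0 ^+ 2) * p%:Z ^+ k.+1.
  rewrite mulrBl -[2 * r * _]mulrA -rt.
  have -> : h * t0 ^+ 2 * p%:Z ^+ k.+1 = (2 * d - a * c) * t0 ^+ 2 by rewrite hd; ring.
  by ring.
have cop : coprimez (p%:Z ^+ k.+1) (n`_p^')%N.
  apply: coprimezXl; rewrite coprimezE /= -[p in coprime p]/(p : nat).
  have := coprime_partC p p n; rewrite part_pnat_id ?pnat_id //.
have [[u v] /= uv] := coprimezP _ _ cop.
(* By the Chinese remainder theorem [t] is [t0] modulo [p ^ k.+1] and 0 modulo the prime-to-[p] part
   of [n]; modulo the latter [N] is 1. *)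
set t := t0 * (v * (n`_p^')%N).
have [w tw] : exists w, t = t0 + w * p%:Z ^+ k.+1.
  exists (- t0 * u); rewrite /t.
  have -> : v * (n`_p^')%N = 1 - u * p%:Z ^+ k.+1 by rewrite -uv; ring.
  by ring.
exists t; set N := a * c * t ^+ 2 + 2 * b * t + 1.
have [z Nz] : exists z, N + 1 = z * p%:Z ^+ k.+1.
  exists (2 * r - h * t0 ^+ 2 + w * (a * c * (2 * t0 + w * p%:Z ^+ k.+1) + 2 * b)).
  rewrite mulrDl -ht0 /N tw; ring.
split; first by apply/dvdzP; exists (z * p); rewrite Nz (exprS _ k); ring.
rewrite -(partnC p n_gt0) PoszM coprimezMr; apply/andP; split.
  apply: coprimez_dvdr (_ : (n`_p %| p ^ (logn p n))%N) _; first by rewrite p_part.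
  rewrite -natz natrX natz; apply: coprimezXr.
  apply/coprimezP; exists (- 1, z * p%:Z ^+ k) => /=.
  have -> : z * p%:Z ^+ k * p%:Z = N + 1 by rewrite Nz (exprS _ k); ring.
  by ring.
apply/coprimezP; exists (1, - (t0 * v) * (a * c * t + 2 * b)) => /=.
by rewrite /N /t; ring.
Qed.

End Congruences.

(** * Integral linear forms, and tensor products of a quadratic map with a lattice *)

Section LinearForms.
Variables (I : finType) (D : zmodType).

Definition lincomb (v : {ffun I -> int}) (x : {ffun I -> D}) : D :=
  \sum_i x i *~ v i.

Fact lincomb_additive v : zmod_morphism (lincomb v).
Proof.
move=> x y; rewrite /lincomb -sumrB; apply: eq_bigr => i _.
by rewrite !ffunE mulrzBl.
Qed.

HB.instance Definition _ v :=
  GRing.isZmodMorphism.Build {ffun I -> D} D (lincomb v) (lincomb_additive v).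

Definition single (i : I) (d : D) : {ffun I -> D} :=
  [ffun j => if j == i then d else 0].

Fact single_additive i : zmod_morphism (single i).
Proof. by move=> d e; apply/ffunP => j; rewrite !ffunE; case: eqP; rewrite ?subr0. Qed.

HB.instance Definition _ i :=
  GRing.isZmodMorphism.Build D {ffun I -> D} (single i) (single_additive i).

Lemma lincomb_single v i d : lincomb v (single i d) = d *~ v i.
Proof.
rewrite /lincomb (bigD1 i) //= ffunE eqxx big1 ?addr0 // => j /negPf ji.
by rewrite ffunE ji mul0rz.
Qed.

Lemma lincombB v w x : lincomb (v - w) x = lincomb v x - lincomb w x.
Proof.
by rewrite /lincomb -sumrB; apply: eq_bigr => i _; rewrite !ffunE mulrzBr.
Qed.

Lemma lincombMn v (n : int) x : lincomb (v *~ n) x = lincomb v x *~ n.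
Proof.
rewrite /lincomb mulrz_suml; apply: eq_bigr => i _.
by rewrite -mulrzA ffunMzE mulrzz.
Qed.

Definition coord_form (i : I) : {ffun I -> int} := [ffun j => (j == i)%:Z].

Lemma lincomb_coord i x : lincomb (coord_form i) x = x i.
Proof.
rewrite /lincomb (bigD1 i) //= ffunE eqxx mulr1z big1 ?addr0 // => j /negPf ji.
by rewrite ffunE ji mulr0z.
Qed.
End LinearForms.

(* [form s] is the tensor product of [q] with the integral lattice whose Gram
   matrix is [gram s]; presenting the lattice as a combination of squares of
   linear forms makes changes of variables immediate. *)
Section TensorForms.
Variables (I : finType) (D : zmodType) (V : comPzRingType) (q : D -> V).
Hypothesis q_quad : quadratic q.
Implicit Types (s : seq (int * {ffun I -> int})) (i j : I) (d e : D).
Local Notation b := (polar q).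

Definition form s (x : {ffun I -> D}) : V :=
  \sum_(l <- s) l.1%:~R * q (lincomb l.2 x).

Definition gram s i j : int := \sum_(l <- s) l.1 * (l.2 i * l.2 j).

Lemma gramC s i j : gram s i j = gram s j i.
Proof. by apply: eq_bigr => l _; rewrite (mulrC (l.2 i)). Qed.

Lemma polar_form s x y :
  polar (form s) x y = \sum_(l <- s) l.1%:~R * b (lincomb l.2 x) (lincomb l.2 y).
Proof.
rewrite /polar /form -!sumrB; apply: eq_bigr => l _.
by rewrite raddfD /=; ring.
Qed.

Lemma quadratic_form s : quadratic (form s).
Proof.
split=> [n x|x y z].
  rewrite mulr_sumr; apply: eq_bigr => l _.
  by rewrite raddfMz /= q_quad.1; ring.
rewrite !polar_form -big_split /=; apply: eq_bigr => l _.
by rewrite raddfD /= (polarDl q_quad); ring.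
Qed.

Lemma polar_form_single s i d x :
  polar (form s) (single i d) x = \sum_j (gram s i j)%:~R * b d (x j).
Proof.
rewrite polar_form.
under eq_bigr => l _.
  rewrite lincomb_single (polarMl q_quad) /lincomb (polar_sumr q_quad) !mulr_sumr.
  over.
rewrite exchange_big /=; apply: eq_bigr => j _.
rewrite rmorph_sum mulr_suml /=; apply: eq_bigr => l _.
by rewrite (polarMr q_quad); ring.
Qed.

Lemma form_single s i d : form s (single i d) = (gram s i i)%:~R * q d.
Proof.
rewrite rmorph_sum mulr_suml /=; apply: eq_bigr => l _.
by rewrite lincomb_single q_quad.1; ring.
Qed.

Lemma polar_form_single2 s i j d e :
  polar (form s) (single i d) (single j e) = (gram s i j)%:~R * b d e.
Proof.
rewrite polar_form_single (bigD1 j) //= ffunE eqxx big1 ?addr0 // => k /negPf kj.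
by rewrite ffunE kj (polar0r q_quad) mulr0.
Qed.

Lemma polar_lincomb d v x :
  b d (lincomb v x) = \sum_(j : I) (v j)%:~R * b d (x j).
Proof.
rewrite /lincomb (polar_sumr q_quad).
by apply: eq_bigr => j _; rewrite (polarMr q_quad).
Qed.

End TensorForms.

(** * Prime power level: splitting lattices into unary and binary pieces *)

Section PrimePowerLevel.
Variables (C : numClosedFieldType) (V : comPzRingType) (psi : V -> C).
Hypothesis psi0 : psi 0 = 1.
Hypothesis psiD : forall u v, psi (u + v) = psi u * psi v.
Hypothesis psiN : forall v, psi (- v) = (psi v)^*.
Variables (D : finZmodType) (q : D -> V).
Hypothesis q_quad : quadratic q.
Hypothesis gauss_real :
  forall n : int, charsum psi (fun x => n%:~R * q x) \is Num.real.
Variables (p k : nat).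
Hypothesis p_prime : prime p.
Hypothesis q_torsion : forall x, (p%:Z ^+ k)%:~R * q x = 0.
Local Notation b := (polar q).

Lemma dvd_mul_q (m : int) x : (p%:Z ^+ k %| m)%Z -> m%:~R * q x = 0.
Proof. by move=> /dvdzP [u ->]; rewrite rmorphM /= -mulrA q_torsion mulr0. Qed.

Lemma dvd_mul_b (m : int) x y : (p%:Z ^+ k %| m)%Z -> m%:~R * b x y = 0.
Proof. by move=> km; rewrite /polar !mulrBr !dvd_mul_q // !subr0. Qed.

Section Binary.
Variables a c e : int.
Hypothesis pa : (p %| a)%Z.
Hypothesis pc : (p %| c)%Z.
Hypothesis pNe : ~~ (p %| e)%Z.

(* [f] is the action of an element of norm [N] of the quadratic order attached to
   the binary form: it multiplies the form by [N], and [N] is -1 modulo [p ^ k].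
   Taking [N] prime to [#|D|] makes [f] bijective although [D] need not be a
   [p]-group. *)
Lemma binary_real (m : int) :
  charsum psi (fun z : D * D =>
    m%:~R * (a%:~R * q z.1 + e%:~R * b z.1 z.2 + c%:~R * q z.2)) \is Num.real.
Proof.
have D_gt0 : (0 < #|D|)%N by apply/card_gt0P; exists 0.
have [t [Nk /coprimezP [[u v] /= uv]]] := neg_multiplier p_prime k D_gt0 pa pc pNe.
set N := a * c * t ^+ 2 + 2 * e * t + 1 in Nk uv.
pose f (z : D * D) := (z.1 - z.2 *~ (c * t), z.1 *~ (a * t) + z.2 *~ (1 + 2 * e * t)).
have D_order (x : D) : x *~ #|D|%:Z = 0.
  by rewrite -pmulrn mulrn_card.
have f_inj : injective f.
  have f0 z : f z = 0 -> z = 0.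
    move=> [/eqP]; rewrite subr_eq0 => /eqP z1 z2.
    have Nz2 : z.2 *~ N = 0.
      by rewrite -z2 z1 -mulrzA -mulrzDr; congr (_ *~ _); rewrite /N; ring.
    have z20 : z.2 = 0.
      by rewrite -[z.2]mulr1z -uv mulrzDr [u * N]mulrC [v * _]mulrC
                 !mulrzA Nz2 D_order !mul0rz addr0.
    by rewrite [z]surjective_pairing z1 z20 mul0rz.
  have fB z w : f (z - w) = f z - f w.
    rewrite /f /=; congr (_, _); rewrite /= !mulrzBl.
      by rewrite !opprB addrACA [RHS]addrACA; congr (_ + _); exact: addrC.
    by rewrite addrACA opprD.
  by move=> z w fzw; apply/eqP; rewrite -subr_eq0; apply/eqP/f0; rewrite fB fzw subrr.
apply: (charsum_real_of_neg psiN (injF_bij f_inj)) => z /=.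
set fz := a%:~R * q z.1 + e%:~R * b z.1 z.2 + c%:~R * q z.2.
have -> : - (m%:~R * fz) = N%:~R * (m%:~R * fz).
  apply/eqP; rewrite -subr_eq0 -opprD oppr_eq0 -{1}[m%:~R * fz]mul1r -mulrDl.
  rewrite -[1]/(1%:~R) -rmorphD addrC /fz.
  have -> : forall r u v w : V, r * (m%:~R * (a%:~R * u + e%:~R * v + c%:~R * w)) =
      m%:~R * (a%:~R * (r * u) + e%:~R * (r * v) + c%:~R * (r * w)).
    by move=> *; ring.
  by rewrite !(dvd_mul_q _ Nk) (dvd_mul_b _ _ Nk) !mulr0 !addr0 mulr0 eqxx.
rewrite !(quadraticD q) !(quadraticN q_quad) !q_quad.1.
rewrite !(polarDr q_quad) !(polarDl q_quad) !(polarNl q_quad) !(polarNr q_quad).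
rewrite !(polarMl q_quad) !(polarMr q_quad) (polarC q z.2 z.1) !(polar_diag q_quad).
by rewrite /fz /N; ring.
Qed.
End Binary.

Variable I : finType.
Implicit Types (s : seq (int * {ffun I -> int})) (S : {set I}).

(** [S] holds the variables not yet eliminated. Forms stay on [{ffun I -> D}] throughout, so the
    index type is constant during the induction. *)
Definition supported S s := forall l, l \in s -> forall j, j \notin S -> l.2 j = 0.

Definition all_real S :=
  forall s, supported S s -> charsum psi (form q s) \is Num.real.

Lemma gram_supported S s i j :
  supported S s -> j \notin S -> gram s i j = 0.
Proof.
move=> sS jS; rewrite /gram big_seq big1 // => l ls.
by rewrite (sS l ls j jS) !mulr0.
Qed.

Lemma real_of_split (X Y : finZmodType) (Q : X -> V)
    (d : {additive Y -> X}) (s : {additive X -> Y}) :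
  (forall y, s (d y) = y) ->
  (forall y x, polar Q (d y) (x - d (s x)) = 0) ->
  charsum psi (Q \o d) \is Num.real ->
  charsum psi (fun x => Q (x - d (s x))) \is Num.real ->
  charsum psi Q \is Num.real.
Proof.
move=> sd orth Rd RP; have := charsum_split psiD sd orth => /(congr1 ( *%R #|Y|%:R^-1)).
by rewrite mulKf ?card_zmod_neq0 // => ->; rewrite !rpredM ?rpredV ?rpred_nat.
Qed.

(** Completing the square in the variable [i]: [t j] plays the quotient of [gram s i j] by
    [gram s i i] modulo [p ^ k]. The split-off part contributes a Gauss sum of a multiple of [q]. *)
Lemma pivot_unary S s i (t : I -> int) :
  supported S s -> i \in S ->
  (forall j, j \in S -> (p%:Z ^+ k %| gram s i j - gram s i i * t j)%Z) ->
  all_real (S :\ i) -> charsum psi (form q s) \is Num.real.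
Proof.
move=> sS iS ht IH.
pose w : {ffun I -> int} :=
  [ffun j => if j == i then 1 else if j \in S then t j else 0].
(* Each linear form is composed with the projection [x - single i (lincomb w x)]; as [w i = 1], its
   coefficient at [i] vanishes. *)
pose s' := [seq (l.1, l.2 - w *~ l.2 i) | l : int * {ffun I -> int} <- s].
apply: (@real_of_split _ _ _ (single i) (lincomb w)).
- by move=> d; rewrite /= lincomb_single ffunE eqxx mulr1z.
- move=> d x /=.
  rewrite (polarBr (quadratic_form q_quad s)) polar_form_single2 //.
  rewrite polar_form_single // polar_lincomb // mulr_sumr -sumrB big1 // => j _.
  rewrite mulrA -rmorphM -mulrBl -rmorphB /= ffunE.
  have [->|ji] := eqVneq j i; first by rewrite mulr1 subrr mul0r.
  case: ifPn => jS; first by rewrite dvd_mul_b // ht.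
  by rewrite (gram_supported _ sS jS) mulr0 subrr mul0r.
- by rewrite (eq_charsum _ (form_single q_quad s i)).
rewrite (_ : charsum _ _ = charsum psi (form q s')); last first.
  apply: eq_charsum => x; rewrite /form big_map; apply: eq_bigr => l _ /=.
  by rewrite lincombB lincombMn raddfB /= lincomb_single.
apply: IH => _ /mapP [l ls ->] j /=.
rewrite !inE negb_and negbK !ffunE ffunMzE ffunE mulrzz => /orP [/eqP ->|jS].
  by rewrite eqxx mul1r subrr.
rewrite (sS l ls j jS) (negPf jS); case: eqP => [ji|_]; last by rewrite mul0r subr0.
by rewrite ji iS in jS.
Qed.

Definition pair2 (i j : I) (z : D * D) : {ffun I -> D} := single i z.1 + single j z.2.

Fact pair2_additive i j : zmod_morphism (pair2 i j).
Proof. by move=> z w; rewrite /pair2 !raddfB /= opprD addrACA. Qed.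

HB.instance Definition _ i j :=
  GRing.isZmodMorphism.Build (D * D)%type {ffun I -> D} (pair2 i j) (pair2_additive i j).

Definition lincomb2 (v w : {ffun I -> int}) (x : {ffun I -> D}) : D * D :=
  (lincomb v x, lincomb w x).

Fact lincomb2_additive v w : zmod_morphism (lincomb2 v w).
Proof. by move=> x y; rewrite /lincomb2 !raddfB. Qed.

HB.instance Definition _ v w :=
  GRing.isZmodMorphism.Build {ffun I -> D} (D * D)%type (lincomb2 v w)
    (lincomb2_additive v w).

(** The analogue of [pivot_unary] for a plane: [t l] and [u l] are the coefficients, modulo [p ^ k],
    of the orthogonal projection of the basis vector [l] to the span of [i] and [j]. The split-off
    part is real by [binary_real]. *)
Lemma pivot_binary S s i j (t u : I -> int) (m a c e : int) :
  supported S s -> i \in S -> j \in S -> i != j ->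
  gram s i i = m * a -> gram s i j = m * e -> gram s j j = m * c ->
  (p %| a)%Z -> (p %| c)%Z -> ~~ (p %| e)%Z ->
  (forall l, l \in S ->
    (p%:Z ^+ k %| gram s i l - gram s i i * t l - gram s i j * u l)%Z) ->
  (forall l, l \in S ->
    (p%:Z ^+ k %| gram s j l - gram s j i * t l - gram s j j * u l)%Z) ->
  all_real (S :\ i :\ j) -> charsum psi (form q s) \is Num.real.
Proof.
move=> sS iS jS ij gii gij gjj pa pc pe hi hj IH.
pose v : {ffun I -> int} := [ffun l =>
  if l == i then 1 else if l == j then 0 else if l \in S then t l else 0].
pose w : {ffun I -> int} := [ffun l =>
  if l == i then 0 else if l == j then 1 else if l \in S then u l else 0].
pose s' := [seq (l.1, l.2 - v *~ l.2 i - w *~ l.2 j) | l : int * {ffun I -> int} <- s].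
have [ji ij'] : (j == i) = false /\ (i == j) = false.
  by rewrite eq_sym (negPf ij).
have orth r d x : r = i \/ r = j ->
    polar (form q s) (single r d) (x - pair2 i j (lincomb2 v w x)) = 0.
  move=> rij; rewrite (polarBr (quadratic_form q_quad s)) (polarDr (quadratic_form q_quad s)).
  rewrite !polar_form_single2 // polar_form_single // !polar_lincomb //.
  rewrite !mulr_sumr -big_split -sumrB big1 //= => l _.
  rewrite !mulrA -!rmorphM -mulrDl -mulrBl -rmorphD -rmorphB /= !ffunE.
  rewrite opprD addrA.
  have [->|li] := eqVneq l i; first by rewrite mulr1 mulr0 subr0 subrr mul0r.
  have [->|lj] := eqVneq l j; first by rewrite mulr1 mulr0 subr0 subrr mul0r.
  case: ifPn => lS; first by rewrite dvd_mul_b //; case: rij => ->; auto.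
  by rewrite (gram_supported _ sS lS) !mulr0 !subrr mul0r.
apply: (@real_of_split _ _ _ (pair2 i j) (lincomb2 v w)).
- move=> [d d']; rewrite /= /lincomb2 /pair2 !raddfD /= !lincomb_single !ffunE.
  by rewrite !eqxx ji ?ij' !mulr1z !mulr0z addr0 add0r.
- move=> z x; rewrite /= (polarDl (quadratic_form q_quad s)).
  by rewrite !orth ?addr0; auto.
- rewrite (eq_charsum _ (Q' := fun z : D * D =>
    m%:~R * (a%:~R * q z.1 + e%:~R * b z.1 z.2 + c%:~R * q z.2))).
    exact: binary_real.
  move=> z; rewrite /= /pair2 (quadraticD (form q s)) !form_single // polar_form_single2 //.
  by rewrite gii gij gjj !rmorphM /=; ring.
rewrite (_ : charsum _ _ = charsum psi (form q s')); last first.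
  apply: eq_charsum => x; rewrite /form big_map; apply: eq_bigr => l _ /=.
  by rewrite !lincombB !lincombMn raddfB /= raddfD /= !lincomb_single opprD addrA.
apply: IH => _ /mapP [l ls ->] r /=.
rewrite !inE !negb_and !negbK !ffunE !ffunMzE !ffunE !mulrzz.
case/or3P=> [/eqP ->|/eqP ->|rS].
- by rewrite eqxx ji mul1r mul0r subr0 subrr.
- by rewrite eqxx mul1r mul0r subr0 subrr.
rewrite (sS l ls r rS) (negPf rS).
have -> : (r == i) = false by apply/eqP => ri; rewrite ri iS in rS.
have -> : (r == j) = false by apply/eqP => rj; rewrite rj jS in rS.
by rewrite !mul0r !subr0.
Qed.

(** Jordan decomposition over the [p]-adic integers, carried out modulo [p ^ k] by induction on the
    number of variables. *)
Lemma form_real_prime_power s : charsum psi (form q s) \is Num.real.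
Proof.
suff H n S : (#|S| <= n)%N -> all_real S.
  by apply: (H #|[set: I]| setT) => // l _ j; rewrite inE.
elim: n S => [|n IH] S; last have [->|[i0 i0S]] := set_0Vmem S.
- rewrite leqn0 cards_eq0 => /eqP -> r rS.
  rewrite (eq_charsum _ (Q' := fun=> 0)) => [|x].
    by rewrite /charsum; apply: rpred_sum => x _; rewrite psi0 rpred1.
  rewrite /form big_seq big1 // => l lr.
  rewrite /lincomb big1 ?(quadratic0 q_quad) ?mulr0 // => i _.
  by rewrite (rS l lr) ?inE // mulr0z.
- by move=> _; apply: IH; rewrite cards0.
move=> Sn r rS.
have IH1 i : i \in S -> all_real (S :\ i).
  by move=> iS; apply: IH; move: Sn; rewrite (cardsD1 i) iS.
(* The largest [w] satisfying [P] is the valuation of the Gram matrix on [S], capped at [k]. *)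
pose P w := (w <= k)%N &&
  [forall i in S, forall j in S, (p%:Z ^+ w %| gram r i j)%Z].
have P0 : exists w, P w.
  by exists 0%N; apply/forall_inP => i _; apply/forall_inP => j _; rewrite expr0 dvd1z.
have Pk w : P w -> (w <= k)%N by case/andP.
have [w /andP [wk /forall_inP Pw] wmax] := ex_maxnP P0 Pk.
have {}Pw i j : i \in S -> j \in S -> exists g, gram r i j = p%:Z ^+ w * g.
  by move=> /Pw /forall_inP Pi /Pi /dvdzP [g ->]; exists g; rewrite mulrC.
(* For [w = k] the Gram matrix on [S] vanishes modulo [p ^ k], so any variable splits off with
   [t = 0]. *)
have [wk'|kw] := ltnP w k; last first.
  have wk' : w = k by apply/eqP; rewrite eqn_leq wk.
  apply: (@pivot_unary S r i0 (fun=> 0)) => //; last exact: IH1.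
  move=> j jS; have [g ->] := Pw i0 j i0S jS.
  by rewrite mulr0 subr0 wk' dvdz_mulr.
have pw0 : p%:Z ^+ w != 0 by rewrite expf_neq0 // eqz_nat -lt0n prime_gt0.
(* A diagonal entry of minimal valuation divides its whole row modulo [p ^ k] and serves as unary
   pivot. *)
have [/existsP [i /andP [iS gi]]|nodiag] :=
    boolP [exists i, (i \in S) && ~~ (p%:Z ^+ w.+1 %| gram r i i)%Z].
  have [g ig] := Pw i i iS iS.
  have pg : ~~ (p %| g)%Z.
    by apply: contra gi => /dvdzP [h hg]; apply/dvdzP; exists h; rewrite ig hg (exprS _ w); ring.
  have [u /dvdzP [v uv]] := modular_inverse p_prime k pg.
  apply: (@pivot_unary S r i (fun j => u * (gram r i j %/ p%:Z ^+ w)%Z)) => //; last exact: IH1.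
  move=> j jS; have [h ->] := Pw i j iS jS.
  rewrite mulKz // ig; apply/dvdzP; exists (p%:Z ^+ w * h * v).
  by rewrite -[RHS]mulrA -uv; ring.
have [i [j [iS jS gij]]] : exists i j,
    [/\ i \in S, j \in S & ~~ (p%:Z ^+ w.+1 %| gram r i j)%Z].
  have : ~~ P w.+1 by apply/negP => /wmax; rewrite ltnn.
  rewrite /P wk' /= negb_forall_in => /existsP [i /andP [iS]].
  by rewrite negb_forall_in => /existsP [j /andP [jS ?]]; exists i, j.
have diag l : l \in S -> exists g, gram r l l = p%:Z ^+ w * (g * p%:Z).
  move=> lS; move: nodiag; rewrite negb_exists => /forallP /(_ l).
  rewrite lS negbK => /dvdzP [g ->]; exists g.
  by rewrite (exprS _ w); ring.
have ij : i != j.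
  apply: contraNneq gij => <-; have [g ->] := diag i iS.
  by apply/dvdzP; exists g; rewrite (exprS _ w); ring.
have [a ga] := diag i iS; have [c gc] := diag j jS.
have [e ge] := Pw i j iS jS.
have pNe : ~~ (p %| e)%Z.
  by apply: contra gij => /dvdzP [h hg]; apply/dvdzP; exists h; rewrite ge hg (exprS _ w); ring.
(* All diagonal entries have valuation above [w] but [e] is a unit, so the rescaled plane is
   unimodular at [p]. *)
have pdet : ~~ (p %| a * p%:Z * (c * p%:Z) - e ^+ 2)%Z.
  apply: contra pNe => pd; have : (p %| e ^+ 2)%Z.
    have -> : e ^+ 2 = a * c * p%:Z * p%:Z - (a * p%:Z * (c * p%:Z) - e ^+ 2) by ring.
    by rewrite rpredB // dvdz_mull.
  by rewrite !dvdzE abszX Euclid_dvdX // => /andP [].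
have [u /dvdzP [v uv]] := modular_inverse p_prime k pdet.
pose x l := (gram r i l %/ p%:Z ^+ w)%Z; pose y l := (gram r j l %/ p%:Z ^+ w)%Z.
(* Cramer's rule for the plane, [u] being the inverse of its determinant modulo [p ^ k]. *)
apply: (@pivot_binary S r i j (fun l => u * (c * p%:Z * x l - e * y l))
  (fun l => u * (a * p%:Z * y l - e * x l)) (p%:Z ^+ w) (a * p%:Z) (c * p%:Z) e) => //.
- by rewrite dvdz_mull.
- by rewrite dvdz_mull.
- move=> l lS; have [g gl] := Pw i l iS lS; have [h hl] := Pw j l jS lS.
  rewrite /x /y gl hl !mulKz // ga ge; apply/dvdzP; exists (p%:Z ^+ w * g * v).
  by rewrite -[RHS]mulrA -uv; ring.
- move=> l lS; have [g gl] := Pw i l iS lS; have [h hl] := Pw j l jS lS.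
  rewrite /x /y (gramC r j i) gl hl !mulKz // gc ge; apply/dvdzP; exists (p%:Z ^+ w * h * v).
  by rewrite -[RHS]mulrA -uv; ring.
apply: IH; move: Sn; rewrite (cardsD1 i) iS => Sn.
by apply: leq_trans (subset_leq_card (subD1set _ _)) _.
Qed.
End PrimePowerLevel.

(** * Arbitrary level, by the Chinese remainder theorem *)

Section AllLevels.
Variables (C : numClosedFieldType) (V : comPzRingType) (psi : V -> C).
Hypothesis psi0 : psi 0 = 1.
Hypothesis psiD : forall u v, psi (u + v) = psi u * psi v.
Hypothesis psiN : forall v, psi (- v) = (psi v)^*.
Variable D : finZmodType.

Lemma form_real (q : D -> V) (N : nat) :
  quadratic q -> (0 < N)%N -> (forall x, N%:R * q x = 0) ->
  (forall n : int, charsum psi (fun x => n%:~R * q x) \is Num.real) ->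
  forall (I : finType) (s : seq (int * {ffun I -> int})),
  charsum psi (form q s) \is Num.real.
Proof.
elim/ltn_ind: N q => N IH q q_quad N_gt0 q_torsion q_real I s.
have [N1|N_neq1] := eqVneq N 1%N.
  (* For [N = 1] the map [q] is zero; the prime 2 is an arbitrary choice. *)
  apply: (form_real_prime_power psi0 psiD psiN q_quad q_real (isT : prime 2) (k := 0)).
  by move=> x; have := q_torsion x; rewrite N1.
have N_gt1 : (1 < N)%N by rewrite ltn_neqAle eq_sym N_neq1.
have p_prime := pdiv_prime N_gt1; set p := pdiv N in p_prime.
pose k := logn p N; pose m := (N`_p^')%N.
have Nmk : N = (p ^ k * m)%N by rewrite -p_part partnC.
have k_gt0 : (0 < k)%N by rewrite logn_gt0 mem_primes p_prime N_gt0 pdiv_dvd.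
have m_gt0 : (0 < m)%N by rewrite part_gt0.
have pk_gt1 : (1 < p ^ k)%N by rewrite -(expn0 p) ltn_exp2l // prime_gt1.
have cop : coprimez (p ^ k)%N m.
  by rewrite coprimezE /= coprimeXl // (pnat_coprime (pnat_id p_prime)) // part_pnat.
have [[u v] /= uv] := coprimezP _ _ cop.
(* The Bezout coefficient [e] is absorbed into the lattice and [c] into [q]; the latter lowers the
   torsion to [m] or [p ^ k]. *)
have scaled_real (c : int) (q' := fun x => c%:~R * q x) :
    (forall (J : finType) (r : seq (int * {ffun J -> int})),
      charsum psi (form q' r) \is Num.real) ->
    forall e : int, charsum psi (fun x => (e * c)%:~R * form q s x) \is Num.real.
  move=> h e; have := h _ [seq (e * l.1, l.2) | l : int * {ffun I -> int} <- s].
  rewrite (eq_charsum _ (Q' := fun x => (e * c)%:~R * form q s x)) // => x.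
  rewrite /form big_map mulr_sumr; apply: eq_bigr => l _ /=.
  by rewrite /q'; ring.
have q'_real (c n : int) :
    charsum psi (fun x => n%:~R * (c%:~R * q x)) \is Num.real.
  by under eq_charsum => x do rewrite mulrA -rmorphM; apply: q_real.
have E : #|{ffun I -> D}|%:R * charsum psi (form q s) =
    charsum psi (fun x => (u * (p ^ k)%N)%:~R * form q s x) *
    charsum psi (fun x => (v * m)%:~R * form q s x).
  apply: charsum_coprime => //; first exact: quadratic_form.
  move=> x; rewrite mulr_sumr big1 // => l _.
  have -> : u * (p ^ k)%N * (v * m) = u * v * N.
    by rewrite Nmk PoszM; ring.
  rewrite rmorphM /= mulrCA -!mulrA.
  by rewrite [N%:~R * _]q_torsion !mulr0.
have -> : charsum psi (form q s) = #|{ffun I -> D}|%:R^-1 *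
  (charsum psi (fun x => (u * (p ^ k)%N)%:~R * form q s x) *
   charsum psi (fun x => (v * m)%:~R * form q s x)).
  by rewrite -E mulKf // card_zmod_neq0.
rewrite !rpredM ?rpredV ?rpred_nat //; apply: scaled_real => // J r.
  have mN : (m < N)%N by rewrite Nmk ltn_Pmull.
  apply: (IH m mN _ (quadraticZ q_quad (p ^ k)%N%:~R) m_gt0) => [x|n].
    by rewrite mulrA -natrM mulnC -Nmk.
  exact: q'_real.
apply: (form_real_prime_power psi0 psiD psiN (quadraticZ q_quad m%:~R) _ p_prime (k := k)) => [n|x].
  exact: q'_real.
have -> : (p%:Z ^+ k)%:~R = (p ^ k)%:R :> V by rewrite natrX rmorphXn.
by rewrite mulrA -natrM -Nmk.
Qed.

End AllLevels.

(** * Fourier inversion and existence of an anti-isometry *)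

Section Existence.
Variables (C : numClosedFieldType) (V : finComNzRingType) (psi : V -> C).
Hypothesis psi0 : psi 0 = 1.
Hypothesis psiD : forall u v, psi (u + v) = psi u * psi v.
Hypothesis psiN : forall v, psi (- v) = (psi v)^*.
Hypothesis psi_eq1 : forall v, psi v = 1 -> v = 0.

Lemma psi_sum (L : finType) (f : L -> V) : psi (\sum_l f l) = \prod_l psi (f l).
Proof. exact: (big_morph psi psiD psi0). Qed.

(** Replacing [c] by [c + 1] multiplies the sum by [psi v], which differs from 1 unless [v = 0]. *)
Lemma orthogonality (v : V) : \sum_c psi (c * v) = #|V|%:R * (v == 0)%:R.
Proof.
have [->|v0] := eqVneq v 0.
  rewrite mulr1 -sumr_const; apply: eq_bigr => c _.
  by rewrite mulr0 psi0.
rewrite mulr0; have : \sum_c psi (c * v) = psi v * \sum_c psi (c * v).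
  rewrite mulr_sumr [LHS](reindex_inj (addIr 1)) /=; apply: eq_bigr => c _.
  by rewrite mulrDl mul1r addrC psiD.
move/eqP; rewrite eq_sym -subr_eq0 -{2}[\sum__ _]mul1r -mulrBl mulf_eq0.
by rewrite subr_eq0 => /orP [/eqP /psi_eq1 v00|/eqP //]; rewrite v00 eqxx in v0.
Qed.

Lemma orthogonality_ffun (L : finType) (v : {ffun L -> V}) :
  \sum_(n : {ffun L -> V}) psi (\sum_l n l * v l) =
  #|V|%:R ^+ #|L| * (v == 0)%:R.
Proof.
under eq_bigr => n _ do rewrite psi_sum.
rewrite -(bigA_distr_bigA (fun l c => psi (c * v l))).
under eq_bigr => l _ do rewrite orthogonality.
rewrite big_split prodr_const /=; congr (_ * _).
have [->|vn0] := eqVneq v 0; first by rewrite big1 // => l _; rewrite ffunE eqxx.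
have /existsP [l vl] : [exists l, v l != 0].
  rewrite -negb_forall; apply: contra vn0 => /forallP v0.
  by apply/eqP/ffunP => l; rewrite ffunE; apply/eqP.
by rewrite (bigD1 l) //= (negPf vl) mul0r.
Qed.

(* Fourier inversion: the numbers of solutions of [F x = F x0] and of
   [F x = - F x0] are complex conjugates of each other. *)
Lemma exists_opposite (X L : finType) (F : X -> {ffun L -> V}) (x0 : X) :
  (forall n : {ffun L -> V},
    charsum psi (fun x => \sum_l n l * F x l) \is Num.real) ->
  exists x, F x = - F x0.
Proof.
move=> F_real.
suff /existsP [x /eqP] : [exists x, F x == - F x0] by exists x.
apply: contraT; rewrite negb_exists => /forallP noF.
pose G (n : {ffun L -> V}) := charsum psi (fun x => \sum_l n l * F x l).
have count (w : {ffun L -> V}) :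
    \sum_(n : {ffun L -> V}) psi (\sum_l n l * w l) * G n =
    \sum_x #|V|%:R ^+ #|L| * (F x + w == 0)%:R.
  under [LHS]eq_bigr => n _ do rewrite mulr_sumr.
  rewrite exchange_big /=; apply: eq_bigr => x _.
  rewrite -orthogonality_ffun; apply: eq_bigr => n _.
  rewrite -psiD -big_split; congr psi; apply: eq_bigr => l _.
  by rewrite ffunE mulrDr addrC.
have := count (F x0); rewrite [X in _ = X]big1 => [|x _]; last first.
  by rewrite addr_eq0 (negPf (noF x)) mulr0.
move=> /(congr1 Num.conj); rewrite rmorph0 rmorph_sum /=.
under eq_bigr => n _.
  rewrite rmorphM /= -psiN (conj_Creal (F_real n)).
  have -> : - (\sum_l n l * F x0 l) = \sum_l n l * (- F x0) l.
    by rewrite -sumrN; apply: eq_bigr => l _; rewrite [in RHS]ffunE mulrN.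
  over.
rewrite count (bigD1 x0) //= subrr eqxx mulr1 => /eqP.
rewrite paddr_eq0 ?exprn_ge0 ?ler0n ?sumr_ge0 //; last first.
  by move=> x _; rewrite mulr_ge0 ?exprn_ge0 ?ler0n.
case/andP=> /eqP V0 _; have := card_zmod_neq0 C V.
by rewrite -[_ == 0]/(_ == 0) => /(expf_neq0 #|L|); rewrite V0 eqxx.
Qed.

Variables (D : finZmodType) (q : D -> V).
Hypothesis q_quad : quadratic q.
Hypothesis q_nondeg : forall x, (forall y, polar q x y = 0) -> x = 0.
Variable lift : V -> int.
Hypothesis liftK : forall v, (lift v)%:~R = v.

Lemma anti_isometry_of_gauss_real :
  (forall n : int, charsum psi (fun x => n%:~R * q x) \is Num.real) ->
  exists gamma : D -> D,
    [/\ bijective gamma, (forall x y, gamma (x + y) = gamma x + gamma y) &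
        forall x, q (gamma x) = - q x].
Proof.
move=> q_real.
(* The boolean selects between the evaluation [f x] (false) and the difference [f x - f y]
   (true). *)
pose vec (l : bool * D * D) := coord_form l.1.2 - coord_form l.2 *~ l.1.1.
have lincomb_vec l (f : {ffun D -> D}) : lincomb (vec l) f = f l.1.2 - f l.2 *~ l.1.1.
  by rewrite lincombB lincombMn !lincomb_coord.
pose F (f : {ffun D -> D}) := [ffun l => q (lincomb (vec l) f)].
have N_gt0 : (0 < #|V|)%N by apply/card_gt0P; exists 0.
have N_torsion x : #|V|%:R * q x = 0 by rewrite mulr_natl mulrn_card.
(* The base point is the identity map. The Fourier coefficients of [F] are sums of [form]s in
   variables indexed by [D], with [lift] supplying integral lattice coefficients. *)
have [n|f Ff] := @exists_opposite _ _ F [ffun x => x].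
  have := form_real psi0 psiD psiN q_quad N_gt0 N_torsion q_real
    [seq (lift (n l), vec l) | l <- enum {: bool * D * D}].
  rewrite (eq_charsum _ (Q' := fun f => \sum_l n l * F f l)) // => f.
  rewrite /form big_map big_enum; apply: eq_bigr => l _.
  by rewrite liftK ffunE.
have qf x : q (f x) = - q x.
  have := congr1 (fun g : {ffun _ -> V} => g (false, x, x)) Ff.
  by rewrite !ffunE !lincomb_vec /= !ffunE !mulr0z !subr0.
have bf x y : polar q (f x) (f y) = - polar q x y.
  have := congr1 (fun g : {ffun _ -> V} => g (true, x, y)) Ff.
  rewrite !ffunE !lincomb_vec /= !ffunE !mulr1z !(quadraticD q) !(quadraticN q_quad).
  rewrite !(polarNr q_quad) !qf => E.
  have -> : polar q (f x) (f y) = - q x - q y - (- q x + - q y + - polar q (f x) (f y)).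
    by ring.
  by rewrite E; ring.
have f_inj : injective f.
  move=> x y fxy; apply/eqP; rewrite -subr_eq0; apply/eqP/q_nondeg => z.
  rewrite (polarDl q_quad) (polarNl q_quad).
  by have := bf x z; rewrite fxy bf => /oppr_inj ->; rewrite subrr.
have f_bij := injF_bij f_inj.
exists f; split=> // x y; have [g fg gf] := f_bij.
(* Additivity is tested against [z = f (g z)], where [bf] reduces it to additivity of the polar
   form. *)
apply/eqP; rewrite -subr_eq0; apply/eqP/q_nondeg => z.
rewrite -(gf z) !(polarDl q_quad) (polarNl q_quad) (polarDl q_quad) !bf.
by rewrite (polarDl q_quad); ring.
Qed.
End Existence.

(** * The exponential and the standard character of Z/N *)

Section Exponential.
Local Notation R := Rdefinitions.R.
Implicit Types t u : R.

Lemma expi0 : expi 0 = 1.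
Proof. by rewrite /expi cos0 sin0. Qed.

Lemma expiD t u : expi (t + u) = expi t * expi u.
Proof.
rewrite /expi trigo.cosD trigo.sinD; apply/eqP.
by rewrite eq_complex /= [sin t * _ + _]addrC !eqxx.
Qed.

Lemma expiN t : expi (- t) = (expi t)^*.
Proof. by rewrite /expi trigo.cosN trigo.sinN. Qed.

Lemma expi_int (m : int) : expi (2 * pi * m%:~R) = 1.
Proof.
have nat_case (n : nat) : expi (2 * pi * n%:R) = 1.
  elim: n => [|n IH]; first by rewrite mulr0 expi0.
  rewrite -(natr1 n) mulrDr expiD IH mul1r mulr1 /expi mulrC mulr_natr.
  by rewrite cos2pi sin2pi.
case: m => n; first exact: nat_case.
by rewrite NegzE mulrNz mulrN expiN nat_case rmorph1.
Qed.

(** The double angle formula gives [sin (pi * t) = 0], whereas the sine is positive strictly between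
    0 and [pi]. *)
Lemma expi_eq1 t : 0 <= t < 1 -> expi (2 * pi * t) = 1 -> t = 0.
Proof.
move=> /andP [t0 t1] [c1 _]; apply/eqP; apply: contraTT isT => tn0.
have tpos : 0 < t by rewrite lt_def tn0.
have : 0 < trigo.sin (pi * t).
  by apply: sin_gt0_pi; rewrite mulr_gt0 ?pi_gt0 //= gtr_pMr ?pi_gt0.
have : trigo.sin (pi * t) ^+ 2 = 0.
  move: c1; rewrite -mulrA mulr_natl cos_mulr2n => c1.
  have := trigo.cos2Dsin2 (pi * t).
  have -> : trigo.cos (pi * t) ^+ 2 = 1 by lra.
  lra.
by move/eqP; rewrite sqrf_eq0 => /eqP ->; rewrite ltxx.
Qed.
End Exponential.

Section ZmodCharacter.
Variable N : nat.
Hypothesis N_gt1 : (1 < N)%N.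
Local Notation R := Rdefinitions.R.

Definition zmod_lift (v : 'Z_N) : int := (v : nat)%:Z.

Lemma zmod_liftK v : (zmod_lift v)%:~R = v.
Proof. exact: natr_Zp. Qed.

Lemma zmod_int_eq0 (m : int) : (m%:~R == 0 :> 'Z_N) = (N %| m)%Z.
Proof.
have nat_case (n : nat) : (n%:R == 0 :> 'Z_N) = (N %| n)%N.
  by rewrite -val_eqE /= val_Zp_nat.
case: m => n; first exact: nat_case.
by rewrite NegzE mulrNz oppr_eq0 nat_case dvdzE abszN.
Qed.

Definition zmod_char (v : 'Z_N) := expi (2 * pi * ((zmod_lift v)%:~R / N%:R)).

Lemma modulus_neq0 : N%:R != 0 :> R.
Proof. by rewrite pnatr_eq0 -lt0n ltnW. Qed.

Lemma zmod_charE (m : int) :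
  zmod_char m%:~R = expi (2 * pi * (m%:~R / N%:R)).
Proof.
have /dvdzP [z mz] : (N %| m - zmod_lift m%:~R)%Z.
  by rewrite -zmod_int_eq0 rmorphB /= zmod_liftK subrr.
rewrite -[m in RHS](subrK (zmod_lift m%:~R)) mz rmorphD rmorphM /= [(_ + _) / _]mulrDl.
by rewrite -[(N%:Z)%:~R]/(N%:R) mulfK ?modulus_neq0 // mulrDr expiD expi_int mul1r.
Qed.

Lemma zmod_char0 : zmod_char 0 = 1.
Proof. by have := zmod_charE 0; rewrite mul0r mulr0 expi0. Qed.

Lemma zmod_charD u v : zmod_char (u + v) = zmod_char u * zmod_char v.
Proof.
rewrite -(zmod_liftK u) -(zmod_liftK v) -rmorphD /= !zmod_charE.
by rewrite rmorphD [(_ + _) / _]mulrDl mulrDr expiD.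
Qed.

Lemma zmod_charN v : zmod_char (- v) = (zmod_char v)^*.
Proof.
by rewrite -(zmod_liftK v) -rmorphN /= !zmod_charE -expiN rmorphN mulNr mulrN.
Qed.

Lemma zmod_char_eq1 v : zmod_char v = 1 -> v = 0.
Proof.
move=> /expi_eq1 v0; apply: val_inj => /=.
have /eqP : (zmod_lift v)%:~R / N%:R = 0 :> R.
  apply: v0; rewrite divr_ge0 ?ler0n //= ltr_pdivrMr ?ltr0n ?(ltnW N_gt1) //.
  by rewrite mul1r ltr_nat -[X in (_ < X)%N](Zp_cast N_gt1).
rewrite mulf_eq0 invr_eq0 (negPf modulus_neq0) orbF => /eqP/eqP.
by rewrite intr_eq0 => /eqP [].
Qed.
End ZmodCharacter.

(** * From values in Q/Z to values in Z/N, and the equivalence *)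

Section Reduction.
Variables (D : finZmodType) (q : D -> rat).
Hypothesis q_form : is_fin_quad_form q.

(** [#|D| ^ 2] already kills [q] modulo 1, since [#|D|] kills [D]. Doubling keeps the level above 1
    for trivial [D], as ['Z_N] is Z/N only for [N > 1]. *)
Definition level := ((#|D| ^ 2).*2)%N.

Lemma level_gt1 : (1 < level)%N.
Proof.
have : (0 < #|D|)%N by apply/card_gt0P; exists 0.
by rewrite /level -double_gt0 -muln2 => h; rewrite -muln2; nia.
Qed.

Lemma level_int x : level%:R * q x \is a Num.int.
Proof.
have [qM _ _ _] := q_form.
have q0 : q 0 \is a Num.int by have := qM 0 0; rewrite /eqQZ mulr0z mul0r subr0.
have := qM #|D|%:Z x; rewrite /eqQZ -pmulrn mulrn_card => h.
have {h} : (#|D| ^ 2)%:R * q x \is a Num.int.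
  rewrite natrX -[X in X \is a _](subKr (q 0)) rpredB //.
  by move: h; rewrite rmorphXn.
by rewrite /level -addnn natrD mulrDl => h; apply: rpredD.
Qed.

Definition numer x : int := Num.floor (level%:R * q x).

Lemma numerE x : (numer x)%:~R = level%:R * q x.
Proof. exact/floorK/level_int. Qed.

Definition qmod x : 'Z_level := (numer x)%:~R.

(** Scaling by [level] turns integers into multiples of [level]; this transports each congruence
    modulo 1 to an equation in ['Z_level]. *)
Lemma reduction (r : rat) (m : int) :
  m%:~R = level%:R * r -> (r \is a Num.int <-> m%:~R = 0 :> 'Z_level).
Proof.
have l0 : level%:R != 0 :> rat by rewrite pnatr_eq0 -lt0n ltnW // level_gt1.
move=> mr; split=> [/intrP [z rz]|/eqP].
  apply/eqP; rewrite (zmod_int_eq0 level_gt1); apply/dvdzP; exists z.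
  by apply: (@intr_inj rat); rewrite mr rz rmorphM mulrC.
rewrite (zmod_int_eq0 level_gt1) => /dvdzP [z mz].
suff -> : r = z%:~R by apply: intr_int.
by apply: (mulfI l0); rewrite -mr mz rmorphM mulrC.
Qed.

Lemma qmod_quadratic : quadratic qmod.
Proof.
have [qM qD _ _] := q_form; split=> [n x|x y z].
  apply/eqP; rewrite -subr_eq0 -rmorphM -rmorphB; apply/eqP.
  apply: ((reduction _).1 (qM n x)).
  by rewrite rmorphB rmorphM /= !numerE; ring.
apply/eqP; rewrite /polar -subr_eq0 -!(rmorphB, rmorphD); apply/eqP.
apply: ((reduction _).1 (qD x y z)).
by rewrite !(rmorphB, rmorphD) /= !numerE /bform; ring.
Qed.

Lemma qmod_nondegenerate x : (forall y, polar qmod x y = 0) -> x = 0.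
Proof.
have [_ _ _ nd] := q_form => h; apply: nd => y; rewrite /eqQZ subr0.
apply/(reduction (m := numer (x + y) - numer x - numer y)).
  by rewrite !rmorphB /= !numerE /bform; ring.
by rewrite !rmorphB; apply: h.
Qed.

Lemma qmodN x y : qmod x = - qmod y <-> eqQZ (q x) (- q y).
Proof.
rewrite /eqQZ opprK (reduction (m := numer x + numer y)); last first.
  by rewrite rmorphD /= !numerE; ring.
have -> : (numer x + numer y)%:~R = qmod x + qmod y by rewrite rmorphD.
by split=> [->|/eqP]; rewrite ?addNr // addr_eq0 => /eqP.
Qed.

Lemma gauss_sumE (n : nat) :
  gauss_sum q n = charsum (@zmod_char level) (fun x => n%:~R * qmod x).
Proof.
apply: eq_bigr => x _; rewrite -rmorphM /= zmod_charE ?level_gt1 //.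
congr (expi (_ * _)); rewrite rmorphM /= -mulrA; congr (_ * _).
have := congr1 (@ratr Rdefinitions.R) (numerE x); rewrite ratr_int rmorphM /= ratr_nat => ->.
by rewrite mulrAC mulfV ?mul1r // modulus_neq0 // level_gt1.
Qed.
End Reduction.

Theorem theorem4 (D : finZmodType) (q : D -> rat) :
  is_fin_quad_form q ->
  (exists gamma : D -> D,
      [/\ bijective gamma,
          (forall x y : D, gamma (x + y) = gamma x + gamma y) &
          (forall x : D, eqQZ (q (gamma x)) (- q x))])
  <-> (forall n : nat, (0 < n)%N -> gauss_sum q n \is Num.real).
Proof.
move=> q_form; have N_gt1 := level_gt1 D; split=> [[gamma [gbij _ qg]] n _|q_real].
  rewrite gauss_sumE //; apply: (charsum_real_of_neg (zmod_charN N_gt1) gbij) => x.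
  by have /(qmodN q_form) -> := qg x; rewrite mulrN.
have [n|gamma [gbij gD qg]] :=
    anti_isometry_of_gauss_real (zmod_char0 N_gt1) (zmod_charD N_gt1)
    (zmod_charN N_gt1) (@zmod_char_eq1 _ N_gt1) (qmod_quadratic q_form)
    (qmod_nondegenerate q_form) (@zmod_liftK _).
  (* Reality is given for positive indices only; [m] is a positive representative of the residue of
     [n]. *)
  pose m := ((n%:~R : 'Z_(level D)) + level D)%N.
  have nm : n%:~R = m%:Z%:~R :> 'Z_(level D).
    rewrite PoszD rmorphD /= -[X in X + _]/((zmod_lift n%:~R)%:~R) zmod_liftK.
    by rewrite -[LHS]addr0; congr (_ + _); apply/esym/eqP; rewrite zmod_int_eq0.
  rewrite nm -gauss_sumE //; apply: q_real.
  by rewrite addn_gt0 (ltnW N_gt1) orbT.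
by exists gamma; split=> // x; apply/(qmodN q_form).
Qed.
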